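(* The $\mathrm{GL}(2)$ tensor product algebra $\mathrm{TA}(2)$ is generated as a $\mathbb{C}$-algebra by \[ g_1=\Delta_0(1,2),\quad g_2=\Delta_1(1),\quad g_3=\Delta_1(\,),\quad g_4=\Delta_2(\,),\quad g_5=\Delta_0(1), \] and these generators are algebraically independent over $\mathbb{C}$. Therefore \[ \mathrm{TA}(2)\cong\mathbb{C}[z_1,z_2,\ldots,z_5]. \] Here $\Delta_i(j_1,\ldots,j_k)$ denotes the minor defined in the context, with $n=2$.
   Context: Let $M_n$ be the space of $n\times n$ complex matrices. On $M_n\oplus M_n$ use coordinates $(x_{ij})$ on the first summand and $(y_{ij})$ on the second, so that $\mathbb{C}[M_n\oplus M_n]=\mathbb{C}[x_{ij},y_{ij}:1\le i,j\le n]$. The group $\mathrm{GL}(n)^3$, with $\mathrm{GL}(n)=\mathrm{GL}_n(\mathbb{C})$, acts on $\mathbb{C}[M_n\oplus M_n]$ by \[ (g\cdot f)(m_1,m_2)=f(g_1^tm_1g_2,\;g_1^tm_2g_3),\qquad g=(g_1,g_2,g_3). \] Let $U_n\subset\mathrm{GL}(n)$ be the subgroup of upper triangular matrices with $1$'s on the diagonal. The $\mathrm{GL}(n)$ tensor product algebra is the invariant algebra \[ \mathrm{TA}(n)=\mathbb{C}[M_n\oplus M_n]^{U_n\times U_n\times U_n}. \] Minors: consider the $n\times 2n$ matrix $[\,x\,|\,y\,]$ whose first $n$ columns are those of $(x_{ij})$ and whose last $n$ columns are those of $(y_{ij})$. For $i\ge0$ and $1\le j_1<\cdots<j_k\le n$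 (with $k\ge 0$ and $1\le i+k\le n$), $\Delta_i(j_1,\ldots,j_k)$ denotes the determinant of the $(i+k)\times(i+k)$ submatrix with rows $1,2,\ldots,i+k$ and columns $1,2,\ldots,i,n+j_1,\ldots,n+j_k$. (In the paper this determinant is denoted by the one-column tableau having $i$ empty boxes followed by boxes with entries $j_1,\ldots,j_k$.) For $k=0$ we write $\Delta_i(\,)$. *)

(* Defs.v *)
From HB Require Import structures.
From mathcomp Require Import all_boot all_order all_algebra.
From mathcomp Require Import boolp reals.
From mathcomp Require Import complex.
From mathcomp Require Import mpoly.

Set Implicit Arguments.
Unset Strict Implicit.
Unset Printing Implicit Defensive.

Import GRing.Theory.
Local Open Scope ring_scope.

Section TensorProductAlgebra.
Variables (K : fieldType) (n : nat).

(* Variable number lshift (mxvec_index i j) is x_ij and variable number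
   rshift (mxvec_index i j) is y_ij. *)
Definition coordRing := {mpoly K[n * n + n * n]}.

Definition Xmx : 'M[coordRing]_n :=
  \matrix_(i, j) 'X_(lshift (n * n) (mxvec_index i j)).

Definition Ymx : 'M[coordRing]_n :=
  \matrix_(i, j) 'X_(rshift (n * n) (mxvec_index i j)).

(* The coordinates of (m1, m2), listed in the order of the variables. *)
Definition coords (A : Type) (m1 m2 : 'M[A]_n) : 'rV[A]_(n * n + n * n) :=
  row_mx (mxvec m1) (mxvec m2).

Definition cst (g : 'M[K]_n) : 'M[coordRing]_n := map_mx (@mpolyC _ K) g.

(* Substitution of the entries of g1^t x g2 for x and of g1^t y g3 for y; the
   formula makes sense for all matrices, and acts_eval gives its values. *)
Definition acts (g1 g2 g3 : 'M[K]_n) (f : coordRing) : coordRing :=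
  f \mPo [tuple coords ((cst g1)^T *m Xmx *m cst g2)
                       ((cst g1)^T *m Ymx *m cst g3) 0 k
         | k < n * n + n * n].

Definition evalAt (f : coordRing) (m1 m2 : 'M[K]_n) : K :=
  f.@[fun k => coords m1 m2 0 k].

Lemma acts_eval g1 g2 g3 f m1 m2 :
  evalAt (acts g1 g2 g3 f) m1 m2 =
  evalAt f (g1^T *m m1 *m g2) (g1^T *m m2 *m g3).
Proof.
rewrite /evalAt /acts comp_mpoly_meval; apply: meval_eq => k.
rewrite tnth_mktuple /coords.
pose ev := meval (fun k => row_mx (mxvec m1) (mxvec m2) 0 k).
have evC (g : 'M[K]_n) : map_mx ev (cst g) = g.
  by apply/matrixP=> i j; rewrite !mxE /ev mevalC.
have evX : map_mx ev Xmx = m1.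
  by apply/matrixP=> i j; rewrite !mxE /ev mevalXU row_mxEl mxvecE.
have evY : map_mx ev Ymx = m2.
  by apply/matrixP=> i j; rewrite !mxE /ev mevalXU row_mxEr mxvecE.
have evE (v : 'rV[coordRing]_(n * n + n * n)) : ev (v 0 k) = map_mx ev v 0 k.
  by rewrite mxE.
by rewrite -/ev evE map_row_mx !map_mxvec !map_mxM !map_trmx !evC evX evY.
Qed.

Definition unitriangular (u : 'M[K]_n) : Prop :=
  (forall i j : 'I_n, (j < i)%N -> u i j = 0) /\ (forall i : 'I_n, u i i = 1).

Lemma unitriangular_unitmx u : unitriangular u -> u \in unitmx.
Proof.
case=> u0 u1; rewrite -unitmx_tr unitmxE det_trig.
  by rewrite big1 ?unitr1 // => i _; rewrite mxE.
by apply/is_trig_mxP=> i j ij; rewrite mxE u0.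
Qed.

Definition TA : {pred coordRing} := fun f =>
  `[< forall u1 u2 u3 : 'M[K]_n,
        unitriangular u1 -> unitriangular u2 -> unitriangular u3 ->
        acts u1 u2 u3 f = f >].

Lemma TAP f :
  reflect (forall u1 u2 u3 : 'M[K]_n,
             unitriangular u1 -> unitriangular u2 -> unitriangular u3 ->
             acts u1 u2 u3 f = f)
          (f \in TA).
Proof. exact: asboolP. Qed.

Lemma TA_subalg_closed : subalg_closed TA.
Proof.
split=> [|a f g /TAP fP /TAP gP|f g /TAP fP /TAP gP];
  apply/TAP=> u1 u2 u3 h1 h2 h3; rewrite /acts.
- exact: rmorph1.
- by rewrite linearP /=; congr (_ *: _ + _); [apply: fP | apply: gP].
- by rewrite rmorphM /=; congr (_ * _); [apply: fP | apply: gP].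
Qed.

HB.instance Definition _ :=
  GRing.isSubalgClosed.Build K {mpoly K[n * n + n * n]} TA TA_subalg_closed.

(* The algebra TA(n) itself, with the operations of the coordinate ring. *)
Record TAalg := MkTAalg { TAval : {mpoly K[n * n + n * n]}; _ : TAval \in TA }.

HB.instance Definition _ := [isSub for TAval].
HB.instance Definition _ := [Choice of TAalg by <:].
HB.instance Definition _ := [SubChoice_isSubAlgebra of TAalg by <:].
HB.instance Definition _ := [SubNzRing_isSubComNzRing of TAalg by <:].

(* The minor with rows 1, ..., i + k and columns 1, ..., i, n + j_1, ...,
   n + j_k of [x | y]; the entries of js are counted from 0, so that the label
   j is the element j - 1 of 'I_n. *)
Definition Delta (i k : nat) (le_ik : (i + k <= n)%N) (js : k.-tuple 'I_n) :
    coordRing :=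
  \det (mxsub (widen_ord le_ik)
              (fun c : 'I_(i + k) =>
                 match split c with
                 | inl a => lshift n (widen_ord (leq_trans (leq_addr k i) le_ik) a)
                 | inr b => rshift n (tnth js b)
                 end)
              (row_mx Xmx Ymx)).

End TensorProductAlgebra.

Arguments TA K n : clear implicits.
Arguments TAalg K n : clear implicits.

Definition in_generated (K : fieldType) (A : algType K) (m : nat)
    (g : m.-tuple A) (f : A) : Prop :=
  forall S : {pred A}, subalg_closed S -> (forall i, tnth g i \in S) -> f \in S.

Definition alg_independent (K : fieldType) (N m : nat)
    (g : m.-tuple {mpoly K[N]}) : Prop :=
  forall p : {mpoly K[m]}, p \mPo g = 0 -> p = 0.

Section GL2.
Variable K : fieldType.

Definition j1 : 'I_2 := @Ordinal 2 0 isT.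
Definition j2 : 'I_2 := @Ordinal 2 1 isT.

Definition gens2 : 5.-tuple (coordRing K 2) :=
  [tuple @Delta K 2 0 2 isT [tuple j1; j2];
         @Delta K 2 1 1 isT [tuple j1];
         @Delta K 2 1 0 isT [tuple];
         @Delta K 2 2 0 isT [tuple];
         @Delta K 2 0 1 isT [tuple j1]].

End GL2.

(* Main.v *)
Require Import Defs.
From HB Require Import structures.
From mathcomp Require Import all_boot all_order all_algebra.
From mathcomp Require Import boolp reals.
From mathcomp Require Import complex.
From mathcomp Require Import mpoly.
From mathcomp Require Import ring.

(** Write x = (a, b; c, d) and y = (e, f; g, h), rows separated by a semicolon.
    The five minors are E = eh - fg, W = ag - ce, a, D = ad - bc and e; they are
    invariant because they are invariant at every point, and over a field of
    characteristic 0 a polynomial is determined by its values ([meval_eq0]).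

    Where a and e do not vanish, the unipotent groups bring a point to the
    normal form x = (a, 0; 0, D/a), y = (e, 0; W/a, E/e) ([TA_normal_form]), so
    that the value of an invariant is a rational function of the five minors.
    Clearing denominators gives (a e)^N f = p(E, W, a, D, e) for a polynomial p
    ([meval_clear_denom]).

    It remains to remove the factors a and e one at a time ([gens2_cancel]).
    If a f = p(E, W, a, D, e), then p(E, W, 0, D, e) vanishes on the locus a = 0.
    There E, W, D and e still take all values with W and e nonzero
    ([genvals_onto]), so p vanishes when its third variable does; hence that
    variable divides p and the factor a can be cancelled.  The factor e is
    treated in the same way.

    The same surjectivity, now at points where a and e are nonzero, shows that
    the minors are algebraically independent.  Sending an invariant to the
    unique polynomial in the minors that equals it is then the isomorphism with
    the polynomial algebra. *)

Set Implicit Arguments.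
Unset Strict Implicit.
Unset Printing Implicit Defensive.
Import GRing.Theory.

Local Open Scope ring_scope.
Local Open Scope complex_scope.

(** * Polynomials and their values *)

Lemma mpoly_ring_ind (R : comNzRingType) n (P : {mpoly R[n]} -> Prop) :
    (forall c, P c%:MP) -> (forall i, P 'X_i) ->
    (forall p q, P p -> P q -> P (p + q)) ->
    (forall p q, P p -> P q -> P (p * q)) ->
  forall p, P p.
Proof.
move=> PC PX PD PM; elim/mpolyind => [|c m p _ _ Pp]; first exact: PC 0.
apply: (PD) => //; rewrite -mul_mpolyC; apply: (PM) => //.
rewrite mpolyXE_id; apply: big_ind => [|//|i _]; first exact: PC 1.
by elim: (m i) => [|k IHk]; rewrite ?expr0 ?exprS; [exact: PC 1 | apply: PM].
Qed.

(** Evaluation one variable at a time: [muni] reads p as a polynomial in its last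
    variable, with coefficients in the other ones. *)
Lemma meval_muni (R : comNzRingType) n (p : {mpoly R[n.+1]}) (v : 'I_n.+1 -> R) :
  p.@[v] = (map_poly (meval (v \o lift ord_max)) (muni p)).[v ord_max].
Proof.
rewrite muniE mevalE raddf_sum horner_sum /=; apply: eq_bigr => m _.
rewrite -!mul_polyC rmorphM /= map_polyXn map_polyC /= hornerCM hornerXn.
rewrite mevalZ mevalX big_ord_recr /= mulrA; congr (_ * _ * _).
apply: eq_bigr => i _; rewrite mnmE.
have -> : widen_ord (leqnSn n) i = lift ord_max i.
  by apply: val_inj; rewrite /= /bump leqNgt ltn_ord.
by congr (_ ^+ m _); apply: val_inj; rewrite /= /bump leqNgt ltn_ord.
Qed.

Lemma muni_inj (R : comNzRingType) n : injective (@muni n R).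
Proof.
apply: raddf_inj => p p0; have {}p0 : muni p = 0 := p0.
apply/mpolyP => m; rewrite mcoeff0.
pose restr (m : 'X_{1..n.+1}) := [multinom m (widen_ord (leqnSn n) i) | i < n].
have restr_inj m1 m2 : restr m1 = restr m2 -> m1 ord_max = m2 ord_max -> m1 = m2.
  move=> /mnmP e1 e2; apply/mnmP => i; case: (unliftP ord_max i) => [j ->|-> //].
  have -> : lift ord_max j = widen_ord (leqnSn n) j.
    by apply: val_inj; rewrite /= /bump leqNgt ltn_ord.
  by have := e1 j; rewrite !mnmE.
case: (boolP (m \in msupp p)) => [mp|/memN_msupp_eq0 //].
have := congr1 (fun q : {poly {mpoly R[n]}} => q`_(m ord_max)@_(restr m)) p0.
rewrite muniE coef0 mcoeff0 coef_sum raddf_sum /= (bigD1_seq m) //=.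
rewrite coefZ coefXn eqxx mulr1 mcoeffZ mcoeffX eqxx mulr1.
rewrite big1 ?addr0 // => m' m'm; rewrite coefZ coefXn.
case: eqP => [e|_]; last by rewrite mulr0 mcoeff0.
rewrite mulr1 mcoeffZ mcoeffX; case: eqP => [e'|_]; last by rewrite mulr0.
by rewrite (restr_inj _ _ e' (esym e)) eqxx in m'm.
Qed.

(** The natural numbers provide more distinct roots than the degree allows. *)
Lemma char0_poly_eq0 (K : fieldType) (K0 : [pchar K] =i pred0) (p : {poly K}) :
  (forall x, p.[x] = 0) -> p = 0.
Proof.
move=> p0; pose rs := [seq i%:R : K | i <- iota 0 (size p)].
apply: (@roots_geq_poly_eq0 _ p rs).
- by apply/allP => x _; rewrite /root p0.
- rewrite map_inj_uniq ?iota_uniq // => i j.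
  wlog le_ij : i j / (i <= j)%N => [W|/eqP].
    by case/orP: (leq_total i j) => ? e; [|apply/esym]; apply: W.
  rewrite eq_sym -subr_eq0 -natrB // (pcharf0P K).1 // subn_eq0 => le_ji.
  by apply/eqP; rewrite eqn_leq le_ij.
- by rewrite size_map size_iota.
Qed.

Lemma meval_eq0 (K : fieldType) (K0 : [pchar K] =i pred0) n (p : {mpoly K[n]}) :
  (forall v, p.@[v] = 0) -> p = 0.
Proof.
elim: n p => [|n IHn] p p0.
  apply/mpolyP => m; have := p0 (fun=> 0).
  have -> : m = 0%MM by apply/mnmP => -[].
  have -> : p = (p@_0)%:MP.
    apply/mpolyP => m'; rewrite mcoeffC.
    by have -> : m' = 0%MM by [apply/mnmP => -[]]; rewrite eqxx mulr1.
  by rewrite mevalC mcoeffC eqxx mulr1 => ->; rewrite mcoeff0.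
apply: muni_inj; rewrite raddf0; apply/polyP => k; rewrite coef0.
apply: IHn => v; pose q := map_poly (meval v) (muni p).
suff q0 : q = 0 by rewrite -[LHS](coef_map (meval v)) -/q q0 coef0.
apply: char0_poly_eq0 => // x.
pose w i := if unlift ord_max i is Some j then v j else x.
have := p0 w; rewrite meval_muni /w unlift_none => <-; congr (_.[_]).
by apply: eq_map_poly => r; apply: meval_eq => i /=; rewrite liftK.
Qed.

(** A polynomial that vanishes on a nonempty principal open set is zero. *)
Lemma mulf_meval_eq0 (K : fieldType) (K0 : [pchar K] =i pred0) n
    (w p : {mpoly K[n]}) :
  w != 0 -> (forall v, w.@[v] != 0 -> p.@[v] = 0) -> p = 0.
Proof.
move=> w0 wp; apply/eqP; suff : w * p == 0 by rewrite mulf_eq0 (negPf w0).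
apply/eqP/(meval_eq0 K0) => v; rewrite mevalM.
by case: (eqVneq w.@[v] 0) => [->|/wp ->]; rewrite ?mul0r ?mulr0.
Qed.

(** Substituting fractions with common denominator w in f gives a fraction whose
    denominator is a power of w. *)
Lemma meval_clear_denom (K : fieldType) n m (q : n.-tuple {mpoly K[m]})
    (w : {mpoly K[m]}) (f : {mpoly K[n]}) :
  exists N (p : {mpoly K[m]}), forall v, w.@[v] != 0 ->
    p.@[v] = w.@[v] ^+ N * f.@[fun i => (tnth q i).@[v] / w.@[v]].
Proof.
elim/mpoly_ring_ind: f => [c|i|f g [N [p fP]] [M [r gP]]|f g [N [p fP]] [M [r gP]]].
- by exists 0%N, c%:MP => v _; rewrite !mevalC mul1r.
- by exists 1%N, (tnth q i) => v v0; rewrite mevalXU mulrC divfK.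
- exists (N + M)%N, (w ^+ M * p + w ^+ N * r) => v v0.
  by rewrite !(mevalD, mevalM, rmorphXn) /= fP // gP // exprD; ring.
- exists (N + M)%N, (p * r) => v v0.
  by rewrite !mevalM fP // gP // exprD; ring.
Qed.

(** Division by a variable; the remainder is p with that variable set to 0. *)
Lemma mpoly_divX (K : fieldType) n (i : 'I_n) (p : {mpoly K[n]}) :
  exists q, p = 'X_i * q + (p \mPo [tuple if j == i then 0 else 'X_j | j < n]).
Proof.
set r := mktuple _.
elim/mpoly_ring_ind: p => [c|j|f g [a e] [b e']|f g [a e] [b e']].
- by exists 0; rewrite comp_mpolyC mulr0 add0r.
- rewrite comp_mpolyXU -tnth_nth tnth_mktuple; case: eqP => [->|_].
    by exists 1; rewrite mulr1 addr0.
  by exists 0; rewrite mulr0 add0r.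
- by exists (a + b); rewrite rmorphD /= {1}e {1}e'; ring.
- exists (a * 'X_i * b + a * (g \mPo r) + b * (f \mPo r)).
  by rewrite rmorphM /= {1}e {1}e'; ring.
Qed.

Lemma mpolyXU_neq0 (K : fieldType) n (i : 'I_n) : ('X_i : {mpoly K[n]}) != 0.
Proof.
apply/eqP => /(congr1 (meval (fun=> 1))); rewrite mevalXU meval0 => /eqP.
by rewrite oner_eq0.
Qed.

Lemma in_generatedP (K : fieldType) n m (g : m.-tuple {mpoly K[n]})
    (f : {mpoly K[n]}) :
  in_generated g f <-> exists p, f = p \mPo g.
Proof.
split=> [|[p ->] S [S1 SL SM] Sg]; last first.
  have S0 : 0 \in S by rewrite -[0](subrr 1) addrC -scaleN1r SL.
  have SZ (c : K) h : h \in S -> c *: h \in S.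
    by move=> Sh; rewrite -[_ *: _]addr0 SL.
  elim/mpoly_ring_ind: p => [c|i|p q pS qS|p q pS qS].
  - by rewrite comp_mpolyC -[_%:MP]mulr1 mul_mpolyC SZ.
  - by rewrite comp_mpolyXU -tnth_nth.
  - by rewrite rmorphD /= -[_ \mPo _ in X in X + _]scale1r SL.
  - by rewrite rmorphM /= SM.
move/(_ (fun h => `[< exists p, h = p \mPo g >])) => genf.
apply/asboolP/genf => [|i]; last first.
  by apply/asboolP; exists 'X_i; rewrite comp_mpolyXU -tnth_nth.
split=> [|c _ _ /asboolP[p ->] /asboolP[q ->]|_ _ /asboolP[p ->] /asboolP[q ->]];
  apply/asboolP.
- by exists 1; rewrite rmorph1.
- by exists (c *: p + q); rewrite linearP.
- by exists (p * q); rewrite rmorphM.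
Qed.

(** * Two by two matrices and values of the five minors *)

Section GL2.
Variable K : fieldType.
Implicit Types (a b c d e f g h r s t : K).

(** The matrix with rows (a, b) and (c, d). *)
Definition mx22 (A : Type) (a b c d : A) : 'M[A]_2 :=
  \matrix_(i, j) if i == 0 then if j == 0 then a else b
                 else if j == 0 then c else d.

Lemma ord2P (P : 'I_2 -> Prop) : P 0 -> P 1 -> forall i, P i.
Proof.
move=> P0 P1 i; have [->//|->//] : i = 0 \/ i = 1.
by case: i => [[|[|//]] lti2]; [left|right]; apply: val_inj.
Qed.

Lemma mx22E (A : Type) (M : 'M[A]_2) : M = mx22 (M 0 0) (M 0 1) (M 1 0) (M 1 1).
Proof. by apply/matrixP; do 2![apply: ord2P]; rewrite mxE. Qed.

Lemma mul_mx22 a b c d e f g h :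
  mx22 a b c d *m mx22 e f g h =
  mx22 (a * e + b * g) (a * f + b * h) (c * e + d * g) (c * f + d * h).
Proof.
by apply/matrixP; do 2![apply: ord2P]; rewrite !mxE big_ord_recl big_ord1 !mxE.
Qed.

Lemma tr_mx22 (A : Type) (a b c d : A) : (mx22 a b c d)^T = mx22 a c b d.
Proof. by apply/matrixP; do 2![apply: ord2P]; rewrite !mxE. Qed.

Lemma det_mx22 a b c d : \det (mx22 a b c d) = a * d - b * c.
Proof.
rewrite (expand_det_row _ 0) big_ord_recl big_ord1 /cofactor !det_mx11 !mxE /=.
by rewrite expr0 expr1; ring.
Qed.

Lemma det_mx2 (M : 'M[K]_2) : \det M = M 0 0 * M 1 1 - M 0 1 * M 1 0.
Proof. by rewrite {1}[M]mx22E det_mx22. Qed.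

Lemma unitriangular_mx22 (u : 'M[K]_2) :
  unitriangular u <-> exists t, u = mx22 1 t 0 1.
Proof.
split=> [[u0 u1]|[t ->]]; last first.
  by split=> [i j|i]; elim/ord2P: i; rewrite ?mxE //; elim/ord2P: j; rewrite ?mxE.
by exists (u 0 1); rewrite {1}[u]mx22E !u1 (u0 1 0).
Qed.

(** At a point, the minor is the determinant of the first i columns of m1 next to
    the columns js of m2, all cut to their first i + k rows. *)
Lemma evalAt_Delta n i k (le_ik : (i + k <= n)%N) (js : k.-tuple 'I_n) m1 m2 :
  evalAt (@Delta K n i k le_ik js) m1 m2 =
  \det (row_mx (mxsub (widen_ord le_ik)
                      (widen_ord (leq_trans (leq_addr k i) le_ik)) m1)
               (mxsub (widen_ord le_ik) (tnth js) m2)).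
Proof.
rewrite /evalAt -det_map_mx map_mxsub map_row_mx; congr (\det _).
apply/matrixP => x y; rewrite mxE [RHS]mxE; case: (split y) => z.
  by rewrite row_mxEl !mxE /= mevalXU row_mxEl mxvecE.
by rewrite row_mxEr !mxE /= mevalXU row_mxEr mxvecE.
Qed.

(** The values (E, W, a, D, e) of the minors at x = (a, b; c, d),
    y = (e, f; g, h), in the order of [gens2]. *)
Definition genvals a b c d e f g h : 5.-tuple K :=
  [tuple e * h - f * g; a * g - c * e; a; a * d - b * c; e].

Lemma evalAt_gens2 a b c d e f g h i :
  evalAt (tnth (gens2 K) i) (mx22 a b c d) (mx22 e f g h) =
  tnth (genvals a b c d e f g h) i.
Proof.
(* The two branches are compared by the value of the index, since [split] does
   not reduce on concrete ordinals. *)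
have split2 m n (j : 'I_(m + n)) (x : 'I_m -> K) (y : 'I_n -> K) v :
    (forall j1 : 'I_m, val j = val j1 -> x j1 = v) ->
    (forall j2 : 'I_n, val j = (m + j2)%N -> y j2 = v) ->
  match split j with inl j1 => x j1 | inr j2 => y j2 end = v.
  by move=> xv yv; case: splitP => j'; [exact: xv|exact: yv].
(* The size is kept as k because it occurs below as 1 + 0 and 0 + 1. *)
have det1 k (M : 'M[K]_k) (z : 'I_k) : k = 1%N -> \det M = M z z.
  by move=> k1; subst k; rewrite det_mx11 (ord1 z).
case: i => [[|[|[|[|[|//]]]]] i5]; rewrite !(tnth_nth 0) /= evalAt_Delta.
- rewrite det_mx2 !mxE.
  by congr (_ * _ - _ * _); apply: split2 => [] [[|[|?]] ?] //= _; rewrite !mxE.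
- rewrite det_mx2 [c * e]mulrC !mxE.
  by congr (_ * _ - _ * _); apply: split2 => [] [[|[|?]] ?] //= _; rewrite !mxE.
- rewrite (det1 _ _ (@Ordinal (1 + 0) 0 isT)) // !mxE.
  by apply: split2 => [] [[|[|?]] ?] //= _; rewrite !mxE.
- rewrite det_mx2 !mxE.
  by congr (_ * _ - _ * _); apply: split2 => [] [[|[|?]] ?] //= _; rewrite !mxE.
- rewrite (det1 _ _ (@Ordinal (0 + 1) 0 isT)) // !mxE.
  by apply: split2 => [] [[|[|?]] ?] //= _; rewrite !mxE.
Qed.

(* The positions of the minors in [gens2]. *)
Local Notation iE := (@Ordinal 5 0 isT).
Local Notation iW := (@Ordinal 5 1 isT).
Local Notation ia := (@Ordinal 5 2 isT).
Local Notation iD := (@Ordinal 5 3 isT).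
Local Notation ie := (@Ordinal 5 4 isT).

(** * Invariants are polynomials in the minors *)

Section CharacteristicZero.
Hypothesis K0 : [pchar K] =i pred0.

Lemma evalAt_eq0 (w p : coordRing K 2) :
    w != 0 ->
    (forall a b c d e f g h,
      evalAt w (mx22 a b c d) (mx22 e f g h) != 0 ->
      evalAt p (mx22 a b c d) (mx22 e f g h) = 0) ->
  p = 0.
Proof.
move=> w0 wp; apply: (mulf_meval_eq0 K0 w0) => v.
pose m1 := vec_mx (lsubmx (\row_k v k)); pose m2 := vec_mx (rsubmx (\row_k v k)).
have vE : (fun k => coords m1 m2 0 k) =1 v.
  by move=> k; rewrite /coords !vec_mxK hsubmxK mxE.
rewrite -!(meval_eq _ vE) -!/(evalAt _ m1 m2) [m1]mx22E [m2]mx22E; exact: wp.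
Qed.

Lemma evalAt_comp_gens2 p a b c d e f g h :
  evalAt (p \mPo gens2 K) (mx22 a b c d) (mx22 e f g h) =
  p.@[tnth (genvals a b c d e f g h)].
Proof.
by rewrite /evalAt comp_mpoly_meval; apply: meval_eq => i; apply: evalAt_gens2.
Qed.

Lemma gens2_TA i : tnth (gens2 K) i \in TA K 2.
Proof.
apply/TAP => _ _ _ /unitriangular_mx22[s ->] /unitriangular_mx22[t ->]
  /unitriangular_mx22[r ->].
apply/eqP; rewrite -subr_eq0; apply/eqP.
apply: (evalAt_eq0 (oner_neq0 _)) => a b c d e f g h _.
rewrite {1}/evalAt mevalB -!/(evalAt _ _ _) acts_eval tr_mx22 !mul_mx22.
apply/eqP; rewrite subr_eq0 !evalAt_gens2; apply/eqP.
by case: i => [[|[|[|[|[|//]]]]] i5]; rewrite !(tnth_nth 0) /=; ring.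
Qed.

Lemma TA_normal_form (p : coordRing K 2) a b c d e f g h :
    p \in TA K 2 -> a != 0 -> e != 0 ->
  evalAt p (mx22 a b c d) (mx22 e f g h) =
  evalAt p (mx22 a 0 0 ((a * d - b * c) / a))
           (mx22 e 0 ((a * g - c * e) / a) ((e * h - f * g) / e)).
Proof.
move=> /TAP pP a0 e0.
have U t : unitriangular (mx22 1 t 0 1) by apply/unitriangular_mx22; exists t.
(* These row and column operations clear c, b and f. *)
rewrite -{1}(pP _ _ _ (U (- c / a)) (U (- b / a)) (U (- f / e))).
rewrite acts_eval tr_mx22 !mul_mx22.
apply: (congr2 (evalAt p)); congr mx22; field; rewrite ?a0 ?e0 //.
Qed.

(** The minors take every system of values in which at least two of W, a and e
    are nonzero. *)
Lemma genvals_onto (v : 'I_5 -> K) :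
  ((v ia != 0) && (v ie != 0)) || ((v iW != 0) && ((v ia != 0) || (v ie != 0))) ->
  exists a b c d e f g h, tnth (genvals a b c d e f g h) =1 v.
Proof.
have E a b c d e f g h : a = v ia -> e = v ie -> e * h - f * g = v iE ->
    a * g - c * e = v iW -> a * d - b * c = v iD ->
    exists a b c d e f g h, tnth (genvals a b c d e f g h) =1 v.
  move=> h2 h4 h0 h1 h3; exists a, b, c, d, e, f, g, h.
  case=> [[|[|[|[|[|//]]]]] i5]; rewrite (tnth_nth 0) /= ?h0 ?h1 ?h3 ?h2 ?h4;
    by apply: (congr1 v); apply: val_inj.
case: (eqVneq (v ia) 0) => [a0|a0] /=; last case: (eqVneq (v ie) 0) => [e0|e0] /=.
- case/andP=> w0 e0.
  by apply: (E 0 (v iD * v ie / v iW) (- v iW / v ie) 0 (v ie) 0 0 (v iE / v ie));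
    rewrite ?a0 //; field; rewrite ?e0 ?w0.
- rewrite andbT => w0.
  by apply: (E (v ia) 0 0 (v iD / v ia) 0 (- v iE * v ia / v iW) (v iW / v ia) 0);
    rewrite ?e0 //; field; rewrite ?a0 ?w0.
- move=> _; apply: (E (v ia) 0 0 (v iD / v ia) (v ie) 0 (v iW / v ia) (v iE / v ie));
    by rewrite //; field; rewrite ?a0 ?e0.
Qed.

Lemma gens2_neq0 i : tnth (gens2 K) i != 0.
Proof.
apply/eqP => /(congr1 (fun P => evalAt P (mx22 1 0 0 1) (mx22 1 0 1 1))) /eqP.
rewrite evalAt_gens2 /evalAt meval0.
by case: i => [[|[|[|[|[|//]]]]] i5];
  rewrite (tnth_nth 0) /= ?mulr1 ?mulr0 ?mul0r ?subr0 oner_eq0.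
Qed.

(** Suppose that the points where the i-th minor vanishes give the other minors
    all systems of values with w nonzero.  Then the i-th minor can be cancelled. *)
Lemma gens2_cancel (i : 'I_5) (w p : {mpoly K[5]}) (f : coordRing K 2) :
    w != 0 ->
    (forall v, w.@[v] != 0 -> exists a b c d e f g h,
       tnth (genvals a b c d e f g h) =1 (fun j => if j == i then 0 else v j)) ->
    tnth (gens2 K) i * f = p \mPo gens2 K ->
  exists q, f = q \mPo gens2 K.
Proof.
move=> w0 onto; have [q ->] := mpoly_divX i p; set r := _ \mPo mktuple _.
move=> fE; have r0 : r = 0.
  apply: (mulf_meval_eq0 K0 w0) => v /onto[a [b [c [d [e [f' [g [h vE]]]]]]]].
  have rv : r.@[v] = r.@[fun j => if j == i then 0 else v j].
    rewrite !comp_mpoly_meval; apply: meval_eq => j; rewrite tnth_mktuple.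
    by case: ifP => [_|ji]; rewrite ?meval0 // !mevalXU ji.
  rewrite rv -(meval_eq _ vE).
  have := congr1 (fun P => evalAt P (mx22 a b c d) (mx22 e f' g h)) fE.
  rewrite evalAt_comp_gens2 /evalAt !mevalD !mevalM -/(evalAt _ _ _) evalAt_gens2.
  by rewrite mevalXU vE eqxx !mul0r add0r.
exists q; apply: (mulfI (gens2_neq0 i)).
by rewrite fE r0 addr0 rmorphM /= comp_mpolyXU -tnth_nth.
Qed.

Lemma TA_localized (f : coordRing K 2) :
  f \in TA K 2 -> exists N p,
    (tnth (gens2 K) ia * tnth (gens2 K) ie) ^+ N * f = p \mPo gens2 K.
Proof.
move=> fTA.
(* The normal form, as a function of the minors, over the denominator w. *)
pose w : {mpoly K[5]} := 'X_ia * 'X_ie.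
pose nf := coords (mx22 ('X_ia * w) 0 0 ('X_iD * 'X_ie))
                  (mx22 ('X_ie * w) 0 ('X_iW * 'X_ie) ('X_iE * 'X_ia)).
have [N [p pE]] := meval_clear_denom [tuple nf 0 k | k < _] w f.
exists N, p.
apply/eqP; rewrite -subr_eq0; apply/eqP.
apply: (@evalAt_eq0 (tnth (gens2 K) ia * tnth (gens2 K) ie)).
  by rewrite mulf_neq0 ?gens2_neq0.
move=> a b c d e f' g h; rewrite /evalAt mevalB !(mevalM, rmorphXn) /= !mevalM.
rewrite -!/(evalAt _ _ _) evalAt_comp_gens2 !evalAt_gens2.
set v := tnth _; rewrite -[v ia]/a -[v ie]/e => ae.
have /andP[a0 e0] : (a != 0) && (e != 0) by rewrite -negb_or -mulf_eq0.
have wE : w.@[v] = a * e by rewrite mevalM !mevalXU.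
rewrite (TA_normal_form _ _ _ _ _ _ fTA a0 e0) pE wE //.
apply/eqP; rewrite subr_eq0; apply/eqP; congr (_ * _).
rewrite /evalAt; apply/esym; apply: meval_eq => k; rewrite tnth_mktuple.
pose phi (P : {mpoly K[5]}) := P.@[v] / (a * e).
have -> : (nf 0 k).@[v] / (a * e) = map_mx phi nf 0 k by rewrite [RHS]mxE.
rewrite map_row_mx !map_mxvec; congr (row_mx (mxvec _) (mxvec _) 0 k).
  apply/matrixP; do 2![apply: ord2P]; rewrite !mxE /phi /= ?meval0 ?mul0r //.
    by rewrite !(mevalM, mevalXU, wE) mulfK.
  by rewrite !(mevalM, mevalXU, wE) /v !(tnth_nth 0) /=; field; rewrite a0 e0.
apply/matrixP; do 2![apply: ord2P]; rewrite !mxE /phi /= ?meval0 ?mul0r //.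
- by rewrite !(mevalM, mevalXU, wE) mulfK.
- by rewrite !(mevalM, mevalXU, wE) /v !(tnth_nth 0) /=; field; rewrite a0 e0.
- by rewrite !(mevalM, mevalXU, wE) /v !(tnth_nth 0) /=; field; rewrite a0 e0.
Qed.

Lemma TA_gens2 (f : coordRing K 2) :
  f \in TA K 2 -> exists q, f = q \mPo gens2 K.
Proof.
case/TA_localized=> N [p].
have zz_neq0 i j : ('X_i * 'X_j : {mpoly K[5]}) != 0
  by rewrite mulf_neq0 ?mpolyXU_neq0.
elim: N p f => [|N IHN] p f; first by rewrite expr0 mul1r => ->; exists p.
rewrite exprSr -mulrA -[X in _ * X]mulrA => /IHN[q].
case/(gens2_cancel (zz_neq0 iW ie)) => [v|r].
  rewrite mevalM !mevalXU mulf_eq0 negb_or => /andP[v1 v4].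
  by apply: genvals_onto; rewrite /= v1 v4 /= !orbT.
case/(gens2_cancel (zz_neq0 iW ia)) => [v|r' ->]; last by exists r'.
rewrite mevalM !mevalXU mulf_eq0 negb_or => /andP[v1 v2].
by apply: genvals_onto; rewrite /= v1 v2 /= ?orbT.
Qed.

Lemma gens2_alg_independent : alg_independent (gens2 K).
Proof.
move=> p p0; have w0 : ('X_ia * 'X_ie : {mpoly K[5]}) != 0
  by rewrite mulf_neq0 ?mpolyXU_neq0.
apply: (mulf_meval_eq0 K0 w0) => v; rewrite mevalM !mevalXU mulf_eq0 negb_or => v0.
have [|a [b [c [d [e [f [g [h vE]]]]]]]] := @genvals_onto v; first by rewrite v0.
by rewrite -(meval_eq _ vE) -evalAt_comp_gens2 p0 /evalAt meval0.
Qed.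

Lemma TA_gens2P (f : coordRing K 2) : f \in TA K 2 <-> in_generated (gens2 K) f.
Proof.
split=> [/TA_gens2 ?|genf]; first exact/in_generatedP.
by apply: genf; [exact: TA_subalg_closed | exact: gens2_TA].
Qed.

Lemma TAalg_iso_mpoly :
  exists phi : {lrmorphism TAalg K 2 -> {mpoly K[5]}}, bijective phi.
Proof.
have phiP (f : TAalg K 2) : {p | TAval f = p \mPo gens2 K}.
  by apply: cid; apply: TA_gens2; exact: (valP f).
pose phi (x : TAalg K 2) := sval (phiP x).
have phiK x : phi x \mPo gens2 K = TAval x by rewrite -(svalP (phiP x)).
have comp_inj p q : p \mPo gens2 K = q \mPo gens2 K -> p = q.
  move=> pq; apply/eqP; rewrite -subr_eq0; apply/eqP.
  by apply: gens2_alg_independent; rewrite rmorphB /= pq subrr.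
have phi_linear : linear phi.
  by move=> c x y; apply: comp_inj; rewrite linearP /= !phiK.
have phi_monoid : monoid_morphism phi.
  by split=> [|x y]; apply: comp_inj; rewrite ?rmorph1 ?rmorphM /= !phiK.
pose phiL := GRing.isLinear.Build _ _ _ _ phi phi_linear.
pose phiM := GRing.isMonoidMorphism.Build _ _ phi phi_monoid.
pose phiLM : {lrmorphism TAalg K 2 -> {mpoly K[5]}} := HB.pack phi phiL phiM.
have compTA (p : {mpoly K[5]}) : p \mPo gens2 K \in TA K 2.
  by apply/TA_gens2P/in_generatedP; exists p.
exists phiLM; exists (fun p => MkTAalg (compTA p)) => [f|p] /=.
  by apply: val_inj; rewrite /= phiK.
by apply: comp_inj; rewrite phiK.
Qed.

End CharacteristicZero.

End GL2.

Theorem theorem3p5 (R : realType) :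
  [/\ (forall f : {mpoly R[i][2 * 2 + 2 * 2]},
         f \in TA R[i] 2 <-> in_generated (gens2 R[i]) f),
      alg_independent (gens2 R[i])
    & exists phi : {lrmorphism TAalg R[i] 2 -> {mpoly R[i][5]}}, bijective phi].
Proof.
have C0 : [pchar R[i]] =i pred0 by exact: Num.Theory.pchar_num.
by split; [exact: TA_gens2P|exact: gens2_alg_independent|exact: TAalg_iso_mpoly].
Qed.
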